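(* For every integer $n\ge 1$, the degree-Kirchhoff index of the linear crossed octagonal-quadrilateral network $Q_n$ is $$Kf^{*}(Q_{n})= \frac{2(324n^{3}+252n^{2}+71n+2)}{3}.$$
   Context: Definition of $Q_n$ (for an integer $n\ge 1$). The linear crossed octagonal-quadrilateral network $Q_n$ is the simple undirected graph with the $8n+2$ vertices $1,2,\ldots,4n+1$ and $1',2',\ldots,(4n+1)'$, and exactly the following $18n+1$ edges: (i) $\{i,i+1\}$ and $\{i',(i+1)'\}$ for $1\le i\le 4n$; (ii) the crossing edges $\{i,(i+1)'\}$ and $\{i',i+1\}$ for $1\le i\le 4n$; (iii) the rungs $\{1,1'\}$, and $\{4k,(4k)'\}$ and $\{4k+1,(4k+1)'\}$ for $1\le k\le n$. Degree-Kirchhoff index. For a simple connected graph $G$ with vertices $v_1,\ldots,v_N$, let $d_i$ be the degree of $v_i$ and let $r_{ij}$ be the resistance distance, i.e. the effective resistance between $v_i$ and $v_j$ in the electrical network obtained from $G$ by placing a unit resistor on each edge. The degree-Kirchhoff index is $Kf^*(G)=\sum_{i<j} d_i d_j r_{ij}$. *)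

(* Defs.v *)
From mathcomp Require Import all_boot all_order all_algebra.
From mathcomp Require Import boolp classical_sets.

Set Implicit Arguments.
Unset Strict Implicit.
Unset Printing Implicit Defensive.

Import Order.TTheory GRing.Theory Num.Theory.

Local Open Scope ring_scope.

Record sgraph := SGraph {
  vertex :> finType;
  adj : rel vertex;
  adj_sym : symmetric adj;
  adj_irr : irreflexive adj }.

Definition connected_graph (G : sgraph) : Prop :=
  forall x y : G, connect (@adj G) x y.

Definition deg (G : sgraph) (x : G) : nat := #|[pred y | adj x y]|.

(* [v] is a potential on the network with a unit resistor on every edge when a
   unit current enters at [x] and leaves at [y]: by Ohm's law the current
   through an edge from [z] to [w] is [v z - v w], and by Kirchhoff's law the
   net current out of [z] is the current injected at [z]. *)
Definition unit_current_potential (R : realFieldType) (G : sgraph) (x y : G)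
    (v : G -> R) : Prop :=
  forall z, \sum_(w | adj z w) (v z - v w) = (z == x)%:R - (z == y)%:R.

(* The voltage drop from [x] to [y] under a unit current; by [resistanceP] it
   exists and does not depend on the potential when [G] is connected. *)
Definition resistance (R : realFieldType) (G : sgraph) (x y : G) : R :=
  xget 0 (fun r => exists2 v, unit_current_potential x y v & r = v x - v y).

(* [enum_rank] numbers the vertices, so that every pair of distinct vertices is
   counted once. *)
Definition degree_kirchhoff (R : realFieldType) (G : sgraph) : R :=
  \sum_(x : G) \sum_(y : G | (enum_rank x < enum_rank y)%N)
    (deg x)%:R * (deg y)%:R * resistance R x y.

Lemma harmonic_const (R : realFieldType) (G : sgraph) (u : G -> R) :
  connected_graph G ->
  (forall z, \sum_(w | adj z w) (u z - u w) = 0) -> forall x y, u x = u y.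
Proof.
move=> conG harm.
suff H m : (forall w, u w <= u m) -> forall y, u y = u m.
  move=> x y; have [m _ le_m] := arg_maxP u (erefl (xpredT x)).
  have {}le_m w : u w <= u m by apply: le_m.
  by rewrite (H m le_m x) (H m le_m y).
move=> le_m y; apply/eqP.
suff cl : closed (@adj G) [pred z | u z == u m].
  by have := closed_connect cl (conG m y); rewrite !inE eqxx.
apply: intro_closed => [|z w zw].
  by apply: sym_connect_sym; apply: adj_sym.
rewrite !inE => /eqP uz.
have ge0 v : adj z v -> 0 <= u z - u v by move=> _; rewrite uz subr_ge0.
have /eqP := psumr_eq0P ge0 (harm z) zw.
by rewrite subr_eq0 uz eq_sym.
Qed.

Lemma unit_current_potential_uniq (R : realFieldType) (G : sgraph) (x y : G)
    (v1 v2 : G -> R) :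
  connected_graph G ->
  unit_current_potential x y v1 -> unit_current_potential x y v2 ->
  v1 x - v1 y = v2 x - v2 y.
Proof.
move=> conG h1 h2.
have E : v1 x - v2 x = v1 y - v2 y.
  apply: (harmonic_const (u := fun z => v1 z - v2 z) conG) => z.
  transitivity (\sum_(w | adj z w) (v1 z - v1 w)
                - \sum_(w | adj z w) (v2 z - v2 w)).
    by rewrite -sumrB; apply: eq_bigr => w _; rewrite !opprD !opprK addrACA.
  by rewrite h1 h2 subrr.
apply/eqP; rewrite subr_eq addrAC -addrA -E; apply/eqP.
by rewrite addrC subrK.
Qed.

Lemma unit_current_potential_exists (R : realFieldType) (G : sgraph) (x y : G) :
  connected_graph G -> exists v : G -> R, unit_current_potential x y v.
Proof.
move=> conG.
pose ev (i : 'I_#|G|) : G := enum_val i.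
pose L : 'M[R]_#|G| := \matrix_(i, j)
  ((i == j)%:R * (deg (ev i))%:R - (adj (ev i) (ev j))%:R).
have LE (u : G -> R) z :
    \sum_(w | adj z w) (u z - u w) =
    \sum_j L (enum_rank z) j * u (ev j).
  under [RHS]eq_bigr => j _ do rewrite mxE /ev enum_rankK mulrBl.
  rewrite sumrB sumrB; congr (_ - _).
    rewrite (bigD1 (enum_rank z)) //= eqxx mul1r enum_rankK.
    rewrite [X in _ = _ + X]big1 ?addr0.
      by rewrite mulr_natl -sumr_const.
    by move=> j /negPf; rewrite eq_sym => ->; rewrite !mul0r.
  rewrite big_mkcond /= (reindex_onto (@enum_val G predT) enum_rank) /=; last first.
    by move=> i _; rewrite enum_rankK.
  rewrite (eq_bigl xpredT) => [|j]; last by rewrite enum_valK eqxx.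
  by apply: eq_bigr => j _; case: ifP; rewrite ?mul1r ?mul0r.
have Lsym : L^T = L.
  apply/matrixP=> i j; rewrite !mxE adj_sym eq_sym.
  by case: eqP => [->|] //; rewrite !mul0r.
pose b : 'rV[R]_#|G| := \row_j ((ev j == x)%:R - (ev j == y)%:R).
have /submxP[v bE] : (b <= L)%MS.
  rewrite submxE; apply/eqP/matrixP=> i k; rewrite !mxE.
  pose u z := cokermx L (enum_rank z) k.
  have uE j : cokermx L j k = u (ev j) by rewrite /u enum_valK.
  have uc : forall z1 z2, u z1 = u z2.
    apply: (harmonic_const conG) => z; rewrite LE.
    have /matrixP/(_ (enum_rank z) k) := mulmx_coker L.
    rewrite !mxE => {2}<-; apply: eq_bigr => j _.
    by rewrite uE.
  under eq_bigr => j _ do rewrite uE (uc _ x) mxE.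
  rewrite -mulr_suml sumrB.
  have S t : \sum_j (ev j == t)%:R = 1 :> R.
    rewrite (bigD1 (enum_rank t)) //= /ev enum_rankK eqxx big1 ?addr0 // => j.
    by rewrite -(inj_eq enum_val_inj) enum_rankK => /negPf ->.
  by rewrite !S subrr mul0r.
exists (fun z => v 0 (enum_rank z)) => z.
rewrite LE.
have /matrixP/(_ 0 (enum_rank z)) := bE; rewrite !mxE /ev enum_rankK => ->.
by apply: eq_bigr => j _; rewrite enum_valK mulrC -[in LHS]Lsym mxE.
Qed.

Lemma resistanceP (R : realFieldType) (G : sgraph) (x y : G) :
  connected_graph G ->
  (exists v : G -> R, unit_current_potential x y v) /\
  (forall v : G -> R,
     unit_current_potential x y v -> resistance R x y = v x - v y).
Proof.
move=> conG; have ex := unit_current_potential_exists R x y conG; split=> // v hv.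
rewrite /resistance; case: xgetP => [r _ [v' hv' ->]|/(_ (v x - v y))[]].
  exact: unit_current_potential_uniq hv' hv.
by exists v.
Qed.

(* The vertex [i] is [(i-1, false)] and [i'] is [(i-1, true)]. *)
Definition Q_vertex (n : nat) : finType := ('I_(4 * n + 1) * bool)%type.

Definition Q_label (n : nat) (x : Q_vertex n) : nat := x.1.+1.
Definition Q_primed (n : nat) (x : Q_vertex n) : bool := x.2.

Definition Q_rung (n i : nat) : bool :=
  (i == 1)%N ||
  [exists k : 'I_n.+1, (1 <= k)%N && ((i == 4 * k)%N || (i == 4 * k + 1)%N)].

(* Each edge is listed in one orientation only. *)
Definition Q_arc (n : nat) (x y : Q_vertex n) : bool :=
  [|| (Q_label y == Q_label x + 1)%N && (Q_primed x == Q_primed y),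
      (Q_label y == Q_label x + 1)%N && (Q_primed x != Q_primed y)
    | [&& Q_label x == Q_label y, Q_rung n (Q_label x),
          ~~ Q_primed x & Q_primed y]].

Definition Q_adj (n : nat) : rel (Q_vertex n) :=
  fun x y => Q_arc x y || Q_arc y x.

Lemma Q_adj_sym n : symmetric (@Q_adj n).
Proof. by move=> x y; rewrite /Q_adj orbC. Qed.

Lemma Q_adj_irr n : irreflexive (@Q_adj n).
Proof.
move=> x; rewrite /Q_adj orbb /Q_arc addn1 eqn_leq ltnn andbF /=.
by rewrite andNb !andbF.
Qed.

Definition Q (n : nat) : sgraph := SGraph (@Q_adj_sym n) (@Q_adj_irr n).

Lemma card_Q n : #|Q n| = (8 * n + 2)%N.
Proof. by rewrite card_prod card_ord card_bool mulnDl mulnAC. Qed.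

Lemma Q_connected n : connected_graph (Q n).
Proof.
have i0P : (0 < 4 * n + 1)%N by rewrite addn1.
pose x0 : Q n := (Ordinal i0P, false).
have csym : connect_sym (@adj (Q n)) by apply/sym_connect_sym/adj_sym.
suff H (x : Q n) : connect (@adj (Q n)) x0 x.
  by move=> x y; apply: connect_trans (H y); rewrite csym.
case: x => [[i ltin] b]; elim: i ltin b => [|i IH] ltin b.
  case: b; last by rewrite (_ : x0 = (Ordinal ltin, false)) //; congr pair; apply: val_inj.
  by apply: connect1; rewrite /= /Q_adj /Q_arc /Q_label /Q_rung.
have lti : (i < 4 * n + 1)%N by apply: ltnW.
apply: connect_trans (IH lti false) _; apply: connect1.
by rewrite /= /Q_adj /Q_arc /Q_label /Q_primed /= addn1 eqxx /=; case: b.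
Qed.

(* Main.v *)
Require Import Defs.
From mathcomp Require Import all_boot all_order all_algebra.
From mathcomp Require Import zify ring lra.

Import Order.TTheory GRing.Theory Num.Theory.
Local Open Scope ring_scope.

(** The network is a chain of columns i = 0, ..., 4n, the column i consisting of
    the two vertices (i, false) and (i, true); consecutive columns are joined
    completely, and a rung joins the two vertices of a column i when i is 0 or 3
    modulo 4.  Exchanging the two vertices of one single column is an
    automorphism, so the Laplacian splits into functions that agree on each
    column and functions that are opposite on each column.

    On the even functions the Laplacian is a multiple of that of a path, for
    which k |-> |k - i| has a point source at i up to a boundary term independent
    of i ([Q_laplacian_dist]).  On the odd functions it is diagonal, since the
    two neighbours in an adjacent column cancel: its value in the column i is
    c_i = D_i + rho_i, with D_i the degree and rho_i the number of rungs there
    ([Q_laplacian_odd]).  Adding the two parts gives an explicit potential, hence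
    ([Q_resistance]), for s the sign +1 or -1 of a vertex within its column,
      r((i, a), (j, b)) =
        |i - j| / 4 + 1 / (2 c_i) + 1 / (2 c_j) - [i = j] s(a) s(b) / c_i.

    The degree depends on the column only, so the last term disappears when one
    sums over the two vertices of each column ([degree_kirchhoff_columns]):
      2 Kf = sum_(i, j) D_i D_j |i - j| + 4 (sum_i D_i / c_i) (sum_i D_i).
    The degrees are periodic of period 4 apart from the two ends, and the three
    sums are polynomials in n, found by adding four columns at a time
    ([open_deg_moments]). *)

(** * Neighbours in the network *)

Lemma sum_ord_indicator (R : pzRingType) (N m : nat) (F : nat -> R) :
  \sum_(q < N) ((q : nat) == m)%:R * F q = (m < N)%:R * F m.
Proof.
have [ltmN|leNm] := ltnP m N; last first.
  rewrite mul0r big1 // => q _.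
  by rewrite ltn_eqF ?mul0r // (leq_trans (ltn_ord q)).
rewrite (bigD1 (Ordinal ltmN)) //= eqxx big1 ?addr0 // => q /negPf.
by rewrite -val_eqE /= => ->; rewrite mul0r.
Qed.

Lemma Q_sum (R : pzRingType) n (F : Q n -> R) :
  \sum_x F x = \sum_(i < 4 * n + 1) (F (i, true) + F (i, false)).
Proof.
rewrite (eq_bigr (fun x : 'I_(4 * n + 1) * bool => F (x.1, x.2))) => [|[]//].
rewrite -(pair_bigA _ (fun i b => F (i, b))) /=.
by apply: eq_bigr => i _; rewrite big_bool.
Qed.

Lemma Q_adjE n (x y : Q n) :
  adj x y = [|| (y.1 : nat) == x.1.+1, (x.1 : nat) == y.1.+1
              | [&& (y.1 : nat) == x.1, y.2 == ~~ x.2 & Q_rung n x.1.+1]].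
Proof.
case: x y => [p b] [q c]; rewrite /= /Q_adj /Q_arc /Q_label /Q_primed /=.
move: (nat_of_ord p) (nat_of_ord q) => {}p {}q.
rewrite !addn1 !eqSS [q == p]eq_sym.
have [->|_] := eqVneq p q; first by case: b; case: c; case: (Q_rung _ _); lia.
by case: b; case: c; lia.
Qed.

(** The degree and the Laplacian are both instances.  Taking [F] on all of [nat]
    makes the missing columns at the two ends harmless: they come with
    coefficient 0. *)
Lemma Q_sum_adj (R : pzRingType) n (F : nat -> bool -> R) (z : Q n) :
  \sum_(w | adj z w) F w.1 w.2 =
    (0 < z.1)%:R * (F z.1.-1 false + F z.1.-1 true)
    + (z.1 < 4 * n)%:R * (F z.1.+1 false + F z.1.+1 true)
    + (Q_rung n z.1.+1)%:R * F z.1 (~~ z.2).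
Proof.
case: z => [p b] /=.
pose G q := F q false + F q true.
rewrite big_mkcond Q_sum /=.
transitivity (\sum_(q < 4 * n + 1)
   (((q : nat) == p.-1)%:R * ((0 < p)%:R * G q)
  + ((q : nat) == p.+1)%:R * G q
  + ((q : nat) == p)%:R * ((Q_rung n p.+1)%:R * F q (~~ b)))).
  apply: eq_bigr => q _; rewrite -![Q_adj _ _]/(@adj (Q n) _ _) !Q_adjE /G /=.
  have -> : ((p : nat) == q.+1) = ((q : nat) == p.-1) && (0 < p)%N by lia.
  have [->|_] := eqVneq (q : nat) p.+1.
    have -> : p.+1 == p.-1 = false by lia.
    have -> : p.+1 == p = false by lia.
    by rewrite /= !mul0r mul1r add0r addr0 addrC.
  have [->|nqp] := eqVneq (q : nat) p.
    have -> : ((p : nat) == p.-1) && (0 < p)%N = false by lia.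
    have -> : ((p : nat) == p.-1)%:R * ((0 < p)%:R * (F p false + F p true))
      = 0.
      case: (posnP p) => [->|p0]; first by rewrite mul0r mulr0.
      by have -> : (p : nat) == p.-1 = false; [lia | rewrite mul0r].
    by case: b; case: (Q_rung _ _); rewrite /= ?(mul0r, mul1r, add0r, addr0).
  by case: (_ == _); case: (0 < p)%N;
    rewrite /= ?(mul0r, mul1r, mulr0, addr0) // addrC.
rewrite !big_split /= (sum_ord_indicator _ _ _ (fun q => (0 < p)%:R * G q)).
rewrite (sum_ord_indicator _ _ _ G).
rewrite (sum_ord_indicator _ _ _ (fun q => (Q_rung n p.+1)%:R * F q (~~ b))).
rewrite ltn_ord mul1r; have := ltn_ord p; move: (nat_of_ord p) => {}p ltp.
have -> : (p.-1 < 4 * n + 1)%N by lia.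
by rewrite mul1r addn1 ltnS.
Qed.

(** * The Laplacian on even and odd functions *)

Definition column_deg (R : pzRingType) n p : R :=
  2 * (0 < p)%:R + 2 * (p < 4 * n)%:R + (Q_rung n p.+1)%:R.

Lemma Q_deg_column (R : pzRingType) n (x : Q n) :
  (deg x)%:R = column_deg R n x.1.
Proof.
rewrite /deg -sum1_card natr_sum (Q_sum_adj R n (fun _ _ => 1)).
rewrite /column_deg mulr1.
by rewrite !mulrDr !mulr1 !mulrDl !mul1r.
Qed.

(** The second difference of a distance vanishes except at [i]; the factor 4 is
    2 for the jump of the slope times 2 for the vertices of a column.  The two
    boundary terms do not depend on [i], so they cancel in the difference of two
    such functions, as they must for a current that enters and leaves. *)
Lemma Q_laplacian_dist (R : realFieldType) n (i : nat) (z : Q n) :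
  (i <= 4 * n)%N ->
  \sum_(w | adj z w) (`|(z.1 : nat)%:R - i%:R| - `|(w.1 : nat)%:R - i%:R|) =
   2 * ((z.1 : nat) == 0%N)%:R + 2 * ((z.1 : nat) == 4 * n)%N%:R
   - 4 * ((z.1 : nat) == i)%:R :> R.
Proof.
move=> ilt.
rewrite (Q_sum_adj R n
  (fun q _ => `|(z.1 : nat)%:R - i%:R| - `|q%:R - i%:R|)) /=.
have := ltn_ord z.1; move: (nat_of_ord z.1) => p; rewrite addn1 ltnS => ltp.
rewrite subrr mulr0 addr0.
have step q : `|q%:R - i%:R| - `|q.+1%:R - i%:R| = 2 * (q < i)%:R - 1 :> R.
  have [qi|iq] := ltnP q i.
    rewrite !ler0_norm ?subr_le0 ?ler_nat ?(ltnW qi) //.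
    by rewrite -[q.+1%:R]natr1 /=; ring.
  rewrite !ger0_norm ?subr_ge0 ?ler_nat ?(leqW iq) //.
  by rewrite -[q.+1%:R]natr1 /=; ring.
rewrite step.
have -> : (p == 4 * n)%N = ~~ (p < 4 * n)%N by lia.
case: p ltp => [|p] ltp.
  have -> : (0 == i)%N = ~~ (0 < i)%N by lia.
  by case: (ltnP 0 (4 * n)) => ?; case: (ltnP 0 i) => ? /=; (lia || ring).
rewrite -[_ - `|p%:R - _|]opprB step.
have -> : (p < i)%N%:R = (p.+1 < i)%N%:R + (p.+1 == i)%:R :> R.
  rewrite [(p < i)%N]leq_eqVlt addrC.
  by have [->|_] := eqVneq p.+1 i; rewrite ?ltnn ?addr0 ?add0r.
case: (ltnP p.+1 (4*n)) => h /=; first by ring.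
have -> : (p.+1 < i)%N = false by lia.
by rewrite /=; ring.
Qed.

Definition side_sign (R : pzRingType) (b : bool) : R := (-1) ^+ b.

Lemma side_sign_sqr (R : pzRingType) b : side_sign R b * side_sign R b = 1.
Proof. by rewrite /side_sign -expr2 sqrr_sign. Qed.

(** The eigenvalue of the Laplacian on the odd functions supported in column [p]:
    a rung counts twice, its far end being at the opposite potential. *)
Definition odd_conductance (R : pzRingType) n p : R :=
  column_deg R n p + (Q_rung n p.+1)%:R.

(** The two neighbours in an adjacent column contribute opposite values, and the
    neighbour across a rung contributes the opposite of the value at [z]: only a
    multiple of the value at [z] is left. *)
Lemma Q_laplacian_odd (R : realFieldType) n (h : nat -> R) (z : Q n) :
  \sum_(w | adj z w) (side_sign R z.2 * h z.1 - side_sign R w.2 * h w.1) =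
  odd_conductance R n z.1 * (side_sign R z.2 * h z.1).
Proof.
rewrite (Q_sum_adj R n
  (fun q c => side_sign R z.2 * h z.1 - side_sign R c * h q)).
rewrite /odd_conductance /column_deg /side_sign.
by case: z.2; rewrite /= ?expr1 ?expr0; ring.
Qed.

Lemma odd_conductance_neq0 (R : realFieldType) n p :
  (0 < n)%N -> odd_conductance R n p != 0.
Proof.
move=> n0; rewrite /odd_conductance /column_deg; apply: lt0r_neq0.
have : (0 < p)%N || (p < 4 * n)%N by lia.
by case: (0 < p)%N; case: (p < _)%N; case: Q_rung => //= _; lra.
Qed.

(** * Resistances *)

(** Half of the unit source at [x] is spread evenly over its column and half is
    odd.  The even halves for [x] and [y] are solved by distances, the odd ones
    by dividing by the eigenvalue.  The formula also gives 0 for [x = y], so the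
    diagonal needs no separate treatment when summing. *)
Lemma Q_resistance (R : realFieldType) n (x y : Q n) : (0 < n)%N ->
  resistance R x y = `|(x.1 : nat)%:R - (y.1 : nat)%:R| / 4
    + (odd_conductance R n x.1)^-1 / 2 + (odd_conductance R n y.1)^-1 / 2
    - (x.1 == y.1)%:R
      * (side_sign R x.2 * side_sign R y.2 / odd_conductance R n x.1).
Proof.
move=> n0.
pose f (i k : nat) : R := `|k%:R - i%:R|.
pose h (k : nat) : R :=
  (k == x.1)%:R * (side_sign R x.2 / (2 * odd_conductance R n x.1))
  - (k == y.1)%:R * (side_sign R y.2 / (2 * odd_conductance R n y.1)).
pose v (w : Q n) := (f y.1 w.1 - f x.1 w.1) / 8 + side_sign R w.2 * h w.1.
have hv : unit_current_potential x y v.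
  move=> z.
  transitivity (8^-1 * (\sum_(w | adj z w) (f y.1 z.1 - f y.1 w.1))
     - 8^-1 * (\sum_(w | adj z w) (f x.1 z.1 - f x.1 w.1))
     + \sum_(w | adj z w) (side_sign R z.2 * h z.1 - side_sign R w.2 * h w.1)).
    rewrite !mulr_sumr -sumrB -big_split /=.
    by apply: eq_bigr => w _; rewrite /v; ring.
  have le (u : Q n) : (u.1 <= 4 * n)%N by have := ltn_ord u.1; lia.
  rewrite !Q_laplacian_dist // (Q_laplacian_odd R n h z) /h.
  have := odd_conductance_neq0 R n x.1 n0.
  have := odd_conductance_neq0 R n y.1 n0.
  (* A point source is the mean of an even and an odd function on its column. *)
  have E (u : Q n) : odd_conductance R n u.1 != 0 ->
     (z == u)%:R = ((z.1 : nat) == u.1)%:R / 2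
       + odd_conductance R n z.1 * side_sign R z.2 *
       (((z.1 : nat) == u.1)%:R * (side_sign R u.2 / (2 * odd_conductance R n u.1))).
    case: z u => [p b] [q c] /=.
    rewrite xpair_eqE -val_eqE /=; case: (eqVneq (p : nat) q) => [<-|_] c0.
      by rewrite /side_sign; case: b; case: c; rewrite /= ?expr1 ?expr0; field.
    by rewrite /=; ring.
  by move=> cy cx; rewrite (E x cx) (E y cy); field; rewrite ?cx ?cy.
rewrite (proj2 (resistanceP R x y (@Q_connected n)) v hv) /v /h /f.
have cx := odd_conductance_neq0 R n x.1 n0.
have cy := odd_conductance_neq0 R n y.1 n0.
rewrite !eqxx !subrr normr0.
rewrite [`|(y.1 : nat)%:R - _|]distrC [(y.1 : nat) == _]eq_sym -val_eqE /=.
transitivity (`|(x.1 : nat)%:R - (y.1 : nat)%:R| / 4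
    + (side_sign R x.2 * side_sign R x.2) * (odd_conductance R n x.1)^-1 / 2
    + (side_sign R y.2 * side_sign R y.2) * (odd_conductance R n y.1)^-1 / 2
    - ((x.1 : nat) == y.1)%:R * (side_sign R x.2 * side_sign R y.2 *
       ((odd_conductance R n x.1)^-1 + (odd_conductance R n y.1)^-1) / 2) : R).
  by field; rewrite cx cy.
rewrite !side_sign_sqr !mul1r; congr (_ - _).
have [<-|_] := eqVneq (x.1 : nat) y.1; last by rewrite !mul0r.
by field.
Qed.

(** * Reduction to sums over columns *)

Lemma sum_sym_enum_rank (R : pzRingType) (T : finType) (F : T -> T -> R) :
  (forall x y, F x y = F y x) -> (forall x, F x x = 0) ->
  \sum_x \sum_y F x y =
  2 * \sum_x \sum_(y | (enum_rank x < enum_rank y)%N) F x y.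
Proof.
move=> Fsym F0.
rewrite mulr_natl mulr2n [X in _ = _ + X](exchange_big_dep xpredT) //=.
rewrite -big_split /=; apply: eq_bigr => x _.
rewrite (bigID (fun y => enum_rank x < enum_rank y)%N) /=.
congr (_ + _); rewrite (bigD1 x) /= ?ltnn // F0 add0r.
apply: eq_big => [y|y _]; last exact: Fsym.
by rewrite -leqNgt ltn_neqAle andbC (inj_eq val_inj) (inj_eq enum_rank_inj).
Qed.

(** The side signs sum to 0 over a column, which removes the only term of the
    resistance that couples the sides; in the rest, summing over the two sides
    of both columns is multiplying by 4. *)
Lemma degree_kirchhoff_columns (R : realFieldType) n : (0 < n)%N ->
  2 * degree_kirchhoff R (Q n) =
  \sum_(i < (4 * n).+1) \sum_(j < (4 * n).+1)
     column_deg R n i * column_deg R n j * `|(i : nat)%:R - (j : nat)%:R|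
  + 4 * ((\sum_(i < (4 * n).+1) column_deg R n i / odd_conductance R n i)
         * \sum_(i < (4 * n).+1) column_deg R n i).
Proof.
move=> n0; rewrite /degree_kirchhoff -sum_sym_enum_rank; first last.
- move=> x; rewrite Q_resistance // subrr normr0 eqxx.
  by rewrite side_sign_sqr mul1r mul0r add0r -splitr div1r subrr mulr0.
- move=> x y; rewrite !Q_resistance // distrC (eq_sym y.1).
  have [->|_] := eqVneq x.1 y.1; last by rewrite /=; ring.
  by rewrite /=; ring.
pose D (i : 'I_(4 * n + 1)) := column_deg R n i.
pose C (i : 'I_(4 * n + 1)) := (odd_conductance R n i)^-1.
transitivity (\sum_(i < 4 * n + 1) \sum_(j < 4 * n + 1)
   (D i * D j * `|(i : nat)%:R - (j : nat)%:R|
    + 2 * (D i * C i * D j + D j * C j * D i))).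
  rewrite Q_sum; apply: eq_bigr => i _; rewrite !Q_sum -big_split /=.
  apply: eq_bigr => j _; rewrite !Q_resistance // !Q_deg_column /= /D /C.
  by rewrite /side_sign !expr1 !expr0; field; rewrite !odd_conductance_neq0.
rewrite addn1 in D C *.
under eq_bigr => i _ do rewrite big_split /= -mulr_sumr big_split /=.
rewrite big_split /=; congr (_ + _).
rewrite -mulr_sumr big_split /=; under eq_bigr => i _ do rewrite -mulr_sumr.
rewrite -mulr_suml; under [X in _ + X]eq_bigr => i _ do rewrite -mulr_suml.
by rewrite -mulr_sumr; ring.
Qed.

(** * Evaluation of the column sums *)

Lemma sum_ord_recr (V : nmodType) (u : nat -> V) N :
  \sum_(i < N.+1) u i = \sum_(i < N) u i + u N.
Proof. exact: big_ord_recr. Qed.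

Lemma sum_dist_rec (R : realFieldType) (u : nat -> R) N :
  \sum_(i < N.+1) \sum_(j < N.+1) u i * u j * `|(i : nat)%:R - (j : nat)%:R| =
  \sum_(i < N) \sum_(j < N) u i * u j * `|(i : nat)%:R - (j : nat)%:R|
  + 2 * u N * \sum_(i < N) u i * (N%:R - (i : nat)%:R).
Proof.
rewrite big_ord_recr /= [X in _ + X]big_ord_recr /= subrr normr0 mulr0 addr0.
under eq_bigr => i _ do rewrite big_ord_recr /=.
rewrite big_split /= -addrA; congr (_ + _); rewrite mulr_sumr -big_split /=.
apply: eq_bigr => i _; rewrite (distrC (i : nat)%:R) ger0_norm; first by ring.
by rewrite subr_ge0 ler_nat ltnW.
Qed.

Lemma sum_lag_rec (R : realFieldType) (u : nat -> R) N :
  \sum_(i < N.+1) u i * (N.+1%:R - (i : nat)%:R) =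
  \sum_(i < N) u i * (N%:R - (i : nat)%:R) + \sum_(i < N.+1) u i.
Proof.
rewrite big_ord_recr /= [X in _ = _ + X]big_ord_recr /= addrA -big_split /=.
rewrite -natr1; congr (_ + _); last by ring.
by apply: eq_bigr => i _; ring.
Qed.

Definition at_rung p := (p %% 4 == 0)%N || (p %% 4 == 3)%N.

Lemma Q_rungE n p : (p <= 4 * n)%N ->
  Q_rung n p.+1 = at_rung p.
Proof.
move=> lep; rewrite /Q_rung /at_rung; apply/idP/idP.
  by case/orP => [|/existsP[k]]; lia.
move=> h; apply/orP; have [->|p0] := posnP p; [by left|right].
have kP : (p.+1 %/ 4 < n.+1)%N by lia.
by apply/existsP; exists (Ordinal kP) => /=; lia.
Qed.

(** The degrees of a chain that continues to the right for ever: these, unlike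
    the true degrees, do not change when the network is lengthened, so that the
    sums over the first columns can be computed by induction. *)
Definition open_deg (R : pzRingType) p : R :=
  4 + (at_rung p)%:R - 2 * (p == 0%N)%:R.

(** The ratio of degree to odd eigenvalue in that chain: 4/4 without a rung, 5/6
    with one, and 3/4 = 1 - 1/6 - 1/12 at the left end. *)
Definition open_ratio (R : unitRingType) p : R :=
  1 - (at_rung p)%:R / 6 - (p == 0%N)%:R / 12.

(** One induction proves the four sums because the last two are driven by the
    others: appending a column adds the total degree, the new column included,
    to the third sum, and twice the new degree times the third sum to the
    fourth. *)
Lemma open_deg_moments (R : realFieldType) n :
  [/\ \sum_(i < 4 * n.+1) open_deg R i = 18 * n.+1%:R - 2,
      \sum_(i < 4 * n.+1) open_ratio R i = 11 / 3 * n.+1%:R - 1 / 12,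
      \sum_(i < 4 * n.+1) open_deg R i * ((4 * n.+1)%N%:R - (i : nat)%:R) =
        36 * n.+1%:R ^+ 2 + n.+1%:R
    & \sum_(i < 4 * n.+1) \sum_(j < 4 * n.+1)
        open_deg R i * open_deg R j * `|(i : nat)%:R - (j : nat)%:R| =
        432 * n.+1%:R ^+ 3 - 144 * n.+1%:R ^+ 2 + 26 * n.+1%:R].
Proof.
have split4 m : (4 * m.+1 = (4 * m).+4)%N by lia.
elim: n => [|n [S E W T]].
  rewrite split4 muln0; rewrite !(sum_dist_rec, sum_lag_rec).
  rewrite !big_ord_recr !big_ord0 /= /open_deg /open_ratio /=.
  by split; field.
rewrite (split4 n.+1).
move: S E W T; set M := (4 * n.+1)%N => S E W T.
have r0 : at_rung M by rewrite /at_rung; lia.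
have r1 : at_rung M.+1 = false by rewrite /at_rung; lia.
have r2 : at_rung M.+2 = false by rewrite /at_rung; lia.
have r3 : at_rung M.+3 by rewrite /at_rung; lia.
have M0 : (M == 0)%N = false by lia.
(* Left transparent, M would unify with a successor, and the recurrences would
   unfold the sums up to M itself. *)
clearbody M.
rewrite !(sum_dist_rec, sum_lag_rec) W T.
rewrite !(sum_ord_recr _ (open_deg R)) !(sum_ord_recr _ (open_ratio R)) S E.
rewrite /open_deg /open_ratio r0 r1 r2 r3 M0 /=.
by split; rewrite -[n.+2%:R]natr1; field.
Qed.

Lemma column_degE (R : realFieldType) n p : (0 < n)%N -> (p < 4 * n)%N ->
  column_deg R n p = open_deg R p.
Proof.
move=> n0 pn; rewrite /column_deg /open_deg Q_rungE ?(ltnW pn) // pn.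
by case: p pn => [|p] _ /=; ring.
Qed.

Lemma column_deg_end (R : realFieldType) n :
  (0 < n)%N -> column_deg R n (4 * n) = 3.
Proof.
move=> n0; rewrite /column_deg Q_rungE // ltnn muln_gt0 n0 /at_rung modnMr /=.
by ring.
Qed.

Lemma column_ratioE (R : realFieldType) n p : (0 < n)%N -> (p < 4 * n)%N ->
  column_deg R n p / odd_conductance R n p = open_ratio R p.
Proof.
move=> n0 pn; rewrite /odd_conductance column_degE // Q_rungE ?(ltnW pn) //.
rewrite /open_deg /open_ratio.
case: p {pn} => [|p] /=; first by field.
by case: at_rung => /=; field.
Qed.

Lemma column_ratio_end (R : realFieldType) n : (0 < n)%N ->
  column_deg R n (4 * n) / odd_conductance R n (4 * n) = 3 / 4.
Proof.
move=> n0; rewrite /odd_conductance column_deg_end // Q_rungE //.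
by rewrite /at_rung modnMr /=; field.
Qed.

(** The last column is the only one where the true degree, 3, differs from that of
    the endless chain, so it is split off before the sums are evaluated. *)
Theorem theorem4p2 (R : realFieldType) (n : nat) (hn : (1 <= n)%N) :
  degree_kirchhoff R (Q n) =
    2 * (324 * n%:R ^+ 3 + 252 * n%:R ^+ 2 + 71 * n%:R + 2) / 3.
Proof.
apply: (@mulfI _ 2); first by rewrite pnatr_eq0.
have := open_deg_moments R n.-1; rewrite prednK // => -[S E W T].
rewrite degree_kirchhoff_columns // (sum_dist_rec _ (column_deg R n)).
rewrite (sum_ord_recr _ (column_deg R n)) column_deg_end //.
rewrite (sum_ord_recr _ (fun i => column_deg R n i / odd_conductance R n i)).
rewrite column_ratio_end //.
under eq_bigr => i _ do under eq_bigr => j _ do rewrite !column_degE //.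
under [X in 2 * 3 * X]eq_bigr => i _ do rewrite column_degE //.
under [X in X + 3 / 4]eq_bigr => i _ do rewrite column_ratioE //.
under [X in X + 3]eq_bigr => i _ do rewrite column_degE //.
by rewrite S E W T; field.
Qed.
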